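(* Let $m,n$ be positive integers with $m<n$ and $m$ odd, and let $G$ be a connected non-complete finite simple graph with maximum degree $\Delta\geq 4$. Then $\chi(G^{\frac{m}{n}})\leq\omega(G^{\frac{m}{n}})+2$.
   Context: For a graph $G$ and positive integer $n$, the $n$-subdivision $G^{\frac{1}{n}}$ is obtained from $G$ by replacing each edge with a path of length $n$. For a graph $H$ and positive integer $m$, the $m$-th power $H^m$ is the graph on $V(H)$ in which two distinct vertices are adjacent iff their distance in $H$ is at most $m$. The fractional power is $G^{\frac{m}{n}}=(G^{\frac{1}{n}})^m$. $\chi$ denotes the chromatic number and $\omega$ the clique number. *)

(* Defs.v *)
(* MathComp *)
From mathcomp Require Import all_boot.

Set Implicit Arguments.
Unset Strict Implicit.
Unset Printing Implicit Defensive.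

Record sgraph := SGraph {
  vertex :> finType;
  adj : rel vertex;
  adj_sym : symmetric adj;
  adj_irrefl : irreflexive adj
}.

Definition connected (G : sgraph) : bool :=
  [forall x : G, forall y : G, connect (@adj G) x y].

Definition complete (G : sgraph) : bool :=
  [forall x : G, forall y : G, (x != y) ==> adj x y].

Definition degree (G : sgraph) (x : G) : nat := #|[set y : G | adj x y]|.

Definition max_degree (G : sgraph) : nat := \max_(x : G) degree x.

Definition clique (G : sgraph) (A : {set G}) : bool :=
  [forall x in A, forall y in A, (x != y) ==> adj x y].

Definition clique_number (G : sgraph) : nat :=
  \max_(A : {set G} | clique A) #|A|.

Definition colorable (G : sgraph) (k : nat) : bool :=
  [exists f : {ffun G -> 'I_k},
    forall x : G, forall y : G, adj x y ==> (f x != f y)].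

Lemma colorable_ex (G : sgraph) : exists k, colorable G k.
Proof.
exists #|G|; apply/existsP; exists [ffun x => enum_rank x].
apply/forallP => x; apply/forallP => y; apply/implyP => xy.
rewrite !ffunE (inj_eq enum_rank_inj).
by apply: contraTneq xy => ->; rewrite adj_irrefl.
Qed.

Definition chromatic_number (G : sgraph) : nat := ex_minn (colorable_ex G).

Definition walk_of_length (G : sgraph) (k : nat) (x y : G) : bool :=
  [exists p : k.-tuple G, path (@adj G) x p && (last x p == y)].

Lemma walk_of_length_sym (G : sgraph) k : symmetric (@walk_of_length G k).
Proof.
have W (x y : G) : walk_of_length k x y -> walk_of_length k y x; last first.
  by move=> x y; apply/idP/idP; apply: W.
rewrite /walk_of_length => /existsP[p /andP[xp /eqP <-]]; apply/existsP.
have sz : size (rev (belast x p)) == k by rewrite size_rev size_belast size_tuple.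
exists (Tuple sz); rewrite /= rev_path; apply/andP; split.
  by rewrite (eq_path (e' := @adj G)) // => u v; rewrite adj_sym.
by case: (tval p) => //= a s; rewrite rev_cons last_rcons.
Qed.

(* The least length of a walk from x to y; a shortest one has length < #|G|.
   The value is #|G| when x and y lie in different components. *)
Definition dist (G : sgraph) (x y : G) : nat :=
  find (fun k => walk_of_length k x y) (iota 0 #|G|).

Section Power.
Variables (G : sgraph) (m : nat).

(* The connectedness clause reads the distance between different components
   as infinite. *)
Definition power_adj : rel G :=
  [rel x y | [&& x != y, connect (@adj G) x y & dist x y <= m]].

Lemma power_adj_sym : symmetric power_adj.
Proof.
move=> x y; rewrite /power_adj /= eq_sym; congr [&& _, _ & _ <= _].
  exact: sym_connect_sym (@adj_sym G) _ _.
by apply: eq_find => k; exact: walk_of_length_sym.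
Qed.

Lemma power_adj_irrefl : irreflexive power_adj.
Proof. by move=> x; rewrite /power_adj /= eqxx. Qed.

Definition power : sgraph := SGraph power_adj_sym power_adj_irrefl.

End Power.

Section Subdivision.
Variables (G : sgraph) (n : nat).

(* Each edge of G is listed once, oriented from its endpoint of smaller rank
   in the enumeration of G; the orientation only serves to number the interior
   points of the path that replaces the edge. *)
Definition oriented_edge : finType :=
  {p : G * G | adj p.1 p.2 && (enum_rank p.1 < enum_rank p.2)}.

Definition sub_vertex : finType := (G + oriented_edge * 'I_n.-1)%type.

(* The k-th point (0 <= k <= n) of the path of length n replacing the edge x:
   its first endpoint if k = 0, its second endpoint if k = n, and the interior
   point of index k - 1 otherwise. *)
Definition sub_point (x : oriented_edge) (k : nat) : sub_vertex :=
  if k == 0 then inl (val x).1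
  else if insub k.-1 is Some i then inr (x, i) else inl (val x).2.

Definition sub_adj : rel sub_vertex :=
  [rel a b | [exists x : oriented_edge, exists k : 'I_n,
     ((a == sub_point x k) && (b == sub_point x k.+1)) ||
     ((b == sub_point x k) && (a == sub_point x k.+1))]].

Lemma sub_adj_sym : symmetric sub_adj.
Proof.
move=> a b; rewrite /sub_adj /=.
by apply: eq_existsb => x; apply: eq_existsb => k; rewrite orbC.
Qed.

Lemma sub_adj_irrefl : irreflexive sub_adj.
Proof.
move=> a; apply/negbTE; rewrite /sub_adj /=.
apply/existsP => -[x /existsP[k]].
rewrite orbb => /andP[/eqP-> /eqP]; rewrite /sub_point /=.
have := ltn_ord k; case: eqP => [->|/eqP k_neq0] lt_kn.
  case: insubP => // _ [uv]; case/andP: (valP x) => + _.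
  by rewrite -uv adj_irrefl.
have lt_k : k.-1 < n.-1 by case: n k k_neq0 lt_kn => // n' [[|k] ?].
rewrite (insubT (fun i => i < n.-1) lt_k) /=.
case: insubP => //= j _ jk [/(congr1 val)/= kj].
by move: k_neq0; rewrite -jk -kj; case: (nat_of_ord k) kj jk => //= k' -> /n_Sn.
Qed.

Definition subdivision : sgraph := SGraph sub_adj_sym sub_adj_irrefl.

End Subdivision.

Definition frac_power (G : sgraph) (m n : nat) : sgraph :=
  power (subdivision G n) m.

(* Main.v *)
Require Import Defs.
From mathcomp Require Import all_boot perm zify.

Set Implicit Arguments.
Unset Strict Implicit.
Unset Printing Implicit Defensive.

(* Write m = 2k + 1 and let D be the maximum degree. The points within distance k
   of a vertex of degree D, together with one more point at distance k + 1, form a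
   clique of size D k + 2, so it suffices to colour with D k + 4 colours: the pairs
   (g, l) with g < D and l < k, and four spare colours.

   First colour the half-edges (u, uv) of G with D colours so that those at one
   vertex differ and the two halves of an edge differ. In a colouring with the
   fewest clashing edges, a clash can be moved along every edge, and moving it all
   over G leaves the colour a of the clash on one of the two halves of each edge of
   a D-regular graph; but each vertex carries only one half-edge of colour a, so
   D <= 2.

   If g and d are the colours of the halves of uv, choose e and f so that g, d, e, f
   differ. The half of the subdivided edge next to u is coloured periodically with
   the 2k + 2 colours 0, (g, 0), ..., (g, k - 1), 1, (e, k - 1), ..., (e, 0), and the
   half next to v likewise with d, f and the spare colours 2 and 3, except that v
   itself has the colour 0. Around u, a point at distance p <= k from u has level
   p - 1, while the levels at a distance p > k on the other edges are at least
   2k + 1 - p, so that equal levels occur only at total distance > m. *)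

(** * Half-edge colourings *)

Section HalfEdgeColoring.
Variables (G : sgraph) (D : nat).
Implicit Types (c : {ffun G * G -> 'I_D}) (u v w x y z : G) (a b : 'I_D).

Definition proper_out c :=
  [forall u : G, forall v : G, forall w : G,
     [&& adj u v, adj u w & c (u, v) == c (u, w)] ==> (v == w)].

Lemma proper_outP c :
  reflect (forall u v w, adj u v -> adj u w -> c (u, v) = c (u, w) -> v = w)
          (proper_out c).
Proof.
apply: (iffP forallP) => [H u v w uv uw cvw | H u].
  by have /forallP/(_ v)/forallP/(_ w) := H u; rewrite uv uw cvw eqxx => /eqP.
apply/forallP => v; apply/forallP => w; apply/implyP => /and3P[uv uw /eqP cvw].
by apply/eqP; apply: H cvw.
Qed.

Definition clashes c : {set G * G} :=
  [set p | adj p.1 p.2 & c p == c (p.2, p.1)].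

Lemma in_clashes c u v :
  ((u, v) \in clashes c) = adj u v && (c (u, v) == c (v, u)).
Proof. by rewrite inE. Qed.

Lemma clashesC c u v : ((u, v) \in clashes c) = ((v, u) \in clashes c).
Proof. by rewrite !in_clashes adj_sym eq_sym. Qed.

Definition recolor c u a b : {ffun G * G -> 'I_D} :=
  [ffun p : G * G => if p.1 == u then tperm a b (c p) else c p].

Lemma proper_out_recolor c u a b : proper_out c -> proper_out (recolor c u a b).
Proof.
move=> /proper_outP cP; apply/proper_outP => x v w xv xw; rewrite !ffunE /=.
by case: eqP => _; [move/perm_inj|]; apply: cP.
Qed.

(** The exchange touches only half-edges at [u]. A new clash on [ux] needs colour [b] at [u] and [a]
    at [x]; the opposite order is impossible, since [uv] is the only edge with colour [a] at [u],
    and its other half is [a] too. *)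
Lemma clashes_recolor c u v b y z (a := c (u, v)) :
    proper_out c -> (u, v) \in clashes c -> b != a ->
    (y, z) \in clashes (recolor c u a b) ->
  [|| (y == u) && (c (u, z) == b) && (c (z, u) == a),
      (z == u) && (c (u, y) == b) && (c (y, u) == a)
    | [&& (y, z) \in clashes c, (y, z) != (u, v) & (y, z) != (v, u)]].
Proof.
move=> /proper_outP cP; rewrite in_clashes => /andP[uv /eqP cuv] ba.
have key x : adj u x -> tperm a b (c (u, x)) = c (x, u) ->
    (c (u, x) == b) && (c (x, u) == a) \/ c (u, x) = c (x, u) /\ x != v.
  move=> ux; case: tpermP => [cux|->|cux _] E.
  - by move: ba; rewrite E (cP _ _ _ ux uv cux) /a cuv eqxx.
  - by left; rewrite -E !eqxx.
  - by right; split=> //; apply/eqP => xv; apply: cux; rewrite xv.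
rewrite in_clashes !ffunE /= => /andP[yz].
have [yu|yu] := eqVneq y u; have [zu|zu] := eqVneq z u.
- by move: yz; rewrite yu zu adj_irrefl.
- rewrite yu in yz *; move/eqP/(key _ yz) => [-> //|[E zv]].
  by rewrite in_clashes yz E !xpair_eqE eqxx (negbTE zu) (negbTE zv) !(andbF,orbT).
- rewrite zu in yz *; move/eqP/esym; rewrite adj_sym in yz.
  move=> /(key _ yz) => -[-> //|[E zv]].
  rewrite in_clashes (adj_sym y) yz E !xpair_eqE eqxx (negbTE yu) (negbTE zv).
  by rewrite !orbT.
- by move=> E; rewrite in_clashes yz E !xpair_eqE (negbTE zu) (negbTE yu) !andbF.
Qed.

Definition clash_minimal c :=
  proper_out c /\ forall c', proper_out c' -> #|clashes c| <= #|clashes c'|.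

(** Otherwise exchanging [b] with the colour of the clash at [u] would remove the clash on [uv] and
    create none, against minimality. *)
Lemma clash_minimal_out c u v b :
    clash_minimal c -> (u, v) \in clashes c ->
  exists x, [/\ adj u x, c (u, x) = b & c (x, u) = c (u, v)].
Proof.
move=> [cP cmin] uvc; have [uv cuv] : adj u v /\ c (u, v) = c (v, u).
  by move: uvc; rewrite in_clashes => /andP[-> /eqP].
have [-> |ba] := eqVneq b (c (u, v)); first by exists v.
have [/existsP[x /and3P[ux /eqP cux /eqP cxu]]|/existsPn none] :=
    boolP [exists x, [&& adj u x, c (u, x) == b & c (x, u) == c (u, v)]].
  by exists x.
have := cmin _ (proper_out_recolor u (c (u, v)) b cP).
suff /proper_card : clashes (recolor c u (c (u, v)) b) \proper clashes c by lia.
apply: (@sub_proper_trans _ _ (pred_of_set (clashes c :\ (u, v)))); last exact: properD1.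
apply/subsetP => -[y z] yzc; rewrite in_setD1.
have yz : adj y z by move: yzc; rewrite in_clashes => /andP[].
case/or3P: (clashes_recolor cP uvc ba yzc) => [||/and3P[-> -> _] //].
- by move=> /andP[/andP[/eqP E E1 E2]]; move: (none z); rewrite -{1}E yz E1 E2.
- move=> /andP[/andP[/eqP E E1 E2]]; move: (none y).
  by rewrite -{1}E adj_sym yz E1 E2.
Qed.

Definition clash_at a c u :=
  clash_minimal c /\ exists2 v, (u, v) \in clashes c & c (u, v) = a.

Lemma clash_at_in a c u x : clash_at a c u -> adj u x -> c (x, u) = a.
Proof.
move=> [cm [v uvc <-]] ux; have [y [uy cuy <-]] := clash_minimal_out (c (u, x)) cm uvc.
by case: cm => /proper_outP cP _; rewrite (cP _ _ _ uy ux cuy).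
Qed.

Lemma clash_at_degree a c u : clash_at a c u -> D <= degree u.
Proof.
move=> [cm [v uvc _]]; rewrite -{1}(card_ord D) -cardsT.
have /subset_leq_card/leq_trans -> // :
    [set: 'I_D] \subset [set c (u, x) | x in [set x : G | adj u x]].
  apply/subsetP => b _; have [y [uy <- _]] := clash_minimal_out b cm uvc.
  by apply/imsetP; exists y; rewrite ?inE.
exact: leq_imset_card.
Qed.

Definition covered a c := [set p : G * G | (c p == a) || (c (p.2, p.1) == a)].

(* Minimality forces every colour [b] to occur at [u] on an edge whose other half
   has the colour [a] of the clash; exchanging [a] and [b] at [u] then moves the
   clash to that edge. *)
Lemma clash_move a c u x :
    clash_at a c u -> adj u x ->
  exists2 c', clash_at a c' x &
    forall y z, adj y z -> (y, z) \in covered a c -> (y, z) \in covered a c'.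
Proof.
move=> ca ux; have cxu := clash_at_in ca ux.
have [[cP cmin] [v uvc cuv]] := ca; have cP' := proper_outP _ cP.
have [uv cvu] : adj u v /\ c (v, u) = a.
  by move: uvc; rewrite in_clashes -cuv => /andP[-> /eqP].
have uNx w : adj u w -> w != u.
  by move=> uw; apply: contraTneq uw => ->; rewrite adj_irrefl.
have [cux|cux] := eqVneq (c (u, x)) a.
  exists c => //; split=> //; exists u => //.
  by rewrite clashesC (cP' _ _ _ ux uv) ?cuv.
have ba : c (u, x) != c (u, v) by rewrite cuv.
exists (recolor c u a (c (u, x))); last first.
  move=> y z yz; rewrite !inE /= !ffunE /=.
  have [yu|yu] := eqVneq y u; have [zu|zu] := eqVneq z u; last by [].
  - by move: yz; rewrite yu zu adj_irrefl.
  (* If the half of [uz] at [u] had colour [a], then [z = v], and the half at [v] keeps the colour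
     [a]. *)
  - rewrite yu in yz *; case/orP => [/eqP E|->]; last by rewrite orbT.
    by rewrite (cP' _ _ _ yz uv) ?cvu ?eqxx ?orbT ?E.
  - rewrite zu adj_sym in yz *; case/orP => [->//|/eqP E].
    by rewrite (cP' _ _ _ yz uv) ?cvu ?eqxx ?E.
split; last first.
  exists u; last by rewrite ffunE /= (negbTE (uNx _ ux)).
  rewrite clashesC in_clashes ux !ffunE /= eqxx (negbTE (uNx _ ux)) tpermR.
  by rewrite cxu eqxx.
split=> [|c' c'P]; first exact: proper_out_recolor.
apply: leq_trans (cmin _ c'P).
(* The new clashes lie among the old ones with both orientations of [uv] traded for those of [ux],
   so their number does not rise and minimality persists. *)
set A := clashes c :\ (u, v) :\ (v, u).
have cA : #|clashes c| = #|A|.+2.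
  rewrite (cardsD1 (u, v)) uvc (cardsD1 (v, u)) in_setD1 -clashesC uvc.
  by rewrite xpair_eqE (negbTE (uNx _ uv)).
apply: (@leq_trans #|(u, x) |: ((x, u) |: A)|); last first.
  by rewrite !cardsU1 cA addnA -addn2 addnC leq_add2l (leq_add (leq_b1 _) (leq_b1 _)).
apply: subset_leq_card.
apply/subsetP => -[y z] yzc; rewrite 2!in_setU1 2!in_setD1.
have yz : adj y z by move: yzc; rewrite in_clashes => /andP[].
rewrite -{1}cuv in yzc.
case/or3P: (clashes_recolor cP uvc ba yzc); rewrite -?andbA.
- move=> /and3P[/eqP E /eqP E1 _]; rewrite E in yz *.
  by rewrite (cP' _ _ _ yz ux E1) eqxx.
- move=> /and3P[/eqP E /eqP E1 _]; rewrite E adj_sym in yz *.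
  by rewrite (cP' _ _ _ yz ux E1) eqxx orbT.
- by move=> /and3P[-> -> ->]; rewrite !orbT.
Qed.

Lemma clash_move_connect a c u x :
    clash_at a c u -> connect (@adj G) u x ->
  exists2 c', clash_at a c' x &
    forall y z, adj y z -> (y, z) \in covered a c -> (y, z) \in covered a c'.
Proof.
move=> ca /connectP[p up ->]; elim: p => [|w p IH] /= in u c ca up *.
  by exists c.
case/andP: up => uw wp; have [c1 c1a sub1] := clash_move ca uw.
have [c2 c2a sub2] := IH _ _ c1a wp.
by exists c2 => // y z yz /(sub1 _ _ yz)/(sub2 _ _ yz).
Qed.

(** The clash travels to each vertex [w] in turn and back to [u]. While it sits at [w], every edge
    at [w] has colour [a] on its far half, and later moves keep these edges covered. *)
Lemma clash_at_covered a c u :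
    connected G -> clash_at a c u ->
  exists2 c', clash_at a c' u & forall y z, adj y z -> (y, z) \in covered a c'.
Proof.
move=> Gc ca.
have conn x y : connect (@adj G) x y by have /forallP/(_ x)/forallP/(_ y) := Gc.
suff [c' c'a cov] : exists2 c', clash_at a c' u &
    forall y z, y \in enum G -> adj y z -> (y, z) \in covered a c'.
  by exists c' => // y z; apply: cov; rewrite mem_enum.
elim: (enum G) => [|w s [c1 c1a cov1]]; first by exists c.
have [c2 c2a sub2] := clash_move_connect c1a (conn u w).
have [c3 c3a sub3] := clash_move_connect c2a (conn w u).
exists c3 => // y z; rewrite inE => /orP[/eqP->|ys] yz.
  apply: (sub3 _ _ yz); rewrite inE /= (clash_at_in c2a yz) eqxx.
  by rewrite orbT.
by apply: (sub3 _ _ yz); apply: (sub2 _ _ yz); apply: cov1.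
Qed.

Lemma clash_free_exists :
    connected G -> 2 < D -> (forall u, degree u <= D) ->
  exists2 c, proper_out c & forall u v, adj u v -> c (u, v) != c (v, u).
Proof.
move=> Gc D_gt2 degD.
have [D' DE] : exists D', D = D'.+1 by exists D.-1; lia.
(* The half-edge from [u] to [v] takes the position of [v] among the neighbours of [u], which the
   degree bound keeps below [D]. *)
pose c0 : {ffun G * G -> 'I_D} := [ffun p : G * G =>
  cast_ord (esym DE) (inord (index p.2 (enum [set y : G | adj p.1 y])))].
have c0P : proper_out c0.
  apply/proper_outP => u v w uv uw; rewrite !ffunE /= => /cast_ord_inj.
  have idx x : adj u x -> index x (enum [set y : G | adj u y]) < D'.+1.
    move=> ux; rewrite -DE (leq_trans _ (degD u)) //.
    by rewrite /degree cardE index_mem mem_enum inE.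
  move=> /(congr1 val) /=; rewrite !inordK ?idx // => E.
  by rewrite -(nth_index v (_ : v \in enum [set y : G | adj u y]))
             ?E ?nth_index ?mem_enum ?inE.
pose c := [arg min_(c < c0 | proper_out c) #|clashes c|].
have cm : clash_minimal c by rewrite /c; case: arg_minnP.
exists c => [|u v uv]; first by case: cm.
apply/negP => cuv.
have ca : clash_at (c (u, v)) c u.
  by split=> //; exists v => //; rewrite in_clashes uv.
have deg w : degree w = D.
  apply/eqP; rewrite eqn_leq degD.
  have [//|c1 c1a _] := @clash_move_connect _ _ _ w ca.
    by have /forallP/(_ u)/forallP/(_ w) := Gc.
  exact: clash_at_degree c1a.
have [c' [[c'P _] _] cov] := clash_at_covered Gc ca.
set a := c (u, v) in cov.
(* [M] has at most one half-edge per vertex, while [M] and its reversal cover all [#|G| * D]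
   half-edges, which would give [D <= 2]. *)
pose M := [set p : G * G | adj p.1 p.2 & c' p == a].
have cM : #|M| <= #|G|.
  have fst_inj : {in M &, injective (@fst G G)}.
    move=> [y z] [y' z']; rewrite !inE /= => /andP[yz /eqP E] /andP[yz' /eqP E'] Ey.
    by rewrite -Ey in yz' E' *; rewrite (proper_outP _ c'P _ _ _ yz yz') ?E.
  by rewrite -(card_in_imset fst_inj) max_card.
pose P := [set p : G * G | adj p.1 p.2].
have cP : #|P| = #|G| * D.
  rewrite -sum1dep_card -(pair_big_dep xpredT (fun y z => adj y z) (fun _ _ => 1)) /=.
  rewrite (eq_bigr (fun=> D)) ?sum_nat_const // => w _.
  by rewrite sum1dep_card; apply: deg.
have : #|P| <= #|M| + #|M|.
  have PM : P \subset M :|: [set (p.2, p.1) | p in M].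
    apply/subsetP => -[y z]; rewrite inE /= => yz; rewrite inE.
    have := cov y z yz; rewrite inE /= => /orP[E|E]; first by rewrite inE yz E.
    by apply/orP; right; apply/imsetP; exists (z, y); rewrite // inE /= adj_sym yz.
  apply: leq_trans (subset_leq_card PM) _.
  by rewrite cardsU (leq_trans (leq_subr _ _)) // leq_add2l leq_imset_card.
have : 0 < #|G| by apply/card_gt0P; exists u.
rewrite cP; nia.
Qed.

End HalfEdgeColoring.

(** * Distances in subdivisions *)

Section Distance.
Variable G : sgraph.
Implicit Types x y z : G.

Definition within l x y :=
  exists2 p, path (@adj G) x p /\ last x p = y & size p <= l.

Lemma within_sym l x y : within l x y -> within l y x.
Proof.
move=> [p [xp pE] lp]; have : walk_of_length (size p) x y.
  by apply/existsP; exists (in_tuple p); rewrite xp pE eqxx.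
rewrite walk_of_length_sym => /existsP[q /andP[yq /eqP qE]].
by exists q => //; rewrite size_tuple.
Qed.

Lemma within_trans k l x y z : within k x y -> within l y z -> within (k + l) x z.
Proof.
move=> [p [xp pE] pk] [q [yq qE] ql]; exists (p ++ q).
  by rewrite cat_path last_cat xp pE.
by rewrite size_cat leq_add.
Qed.

Lemma withinW k l x y : k <= l -> within k x y -> within l x y.
Proof. by move=> kl [p pP pk]; exists p => //; apply: leq_trans kl. Qed.

(** Cutting a walk down to a simple path brings its length below [#|G|], into the range that [dist]
    searches. *)
Lemma power_adjP m x y :
  reflect (x != y /\ within m x y) (@adj (power G m) x y).
Proof.
rewrite /= /power_adj /=; apply: (iffP and3P) => [[xy xcy xym]|[xy [p [xp pE] pm]]].
  split=> //; have [p xp pE] := connectP xcy.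
  case: (shortenP xp) pE => p' xp' Up' _ pE.
  have szp : size p' < #|G| by have := max_card (mem (x :: p')); rewrite (card_uniqP Up').
  have : has (fun k => walk_of_length k x y) (iota 0 #|G|).
    apply/hasP; exists (size p'); first by rewrite mem_iota.
    by apply/existsP; exists (in_tuple p'); rewrite xp' pE eqxx.
  move=> Hh; have := nth_find 0 Hh; rewrite has_find size_iota in Hh.
  rewrite nth_iota // add0n => /existsP[q /andP[xq /eqP qE]].
  by exists q => //; rewrite size_tuple.
split=> //; first by apply/connectP; exists p.
apply: leq_trans pm; rewrite /dist leqNgt; apply/negP => lt_find.
have szp : size p < #|G|.
  by apply: leq_trans lt_find _; rewrite -[X in _ <= X](size_iota 0) find_size.
have := before_find 0 lt_find; rewrite nth_iota // add0n.
by move/existsP; apply; exists (in_tuple p); rewrite xp pE eqxx.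
Qed.

Lemma colorable_finType (C : finType) (f : G -> C) :
  (forall x y, adj x y -> f x != f y) -> colorable G #|C|.
Proof.
move=> fP; apply/existsP; exists [ffun x => enum_rank (f x)].
apply/forallP => x; apply/forallP => y; apply/implyP => xy.
by rewrite !ffunE (inj_eq enum_rank_inj) fP.
Qed.

Lemma chromatic_number_le k : colorable G k -> chromatic_number G <= k.
Proof. by rewrite /chromatic_number; case: ex_minnP => n _ + Gk; apply. Qed.

Lemma clique_number_ge (A : {set G}) : clique A -> #|A| <= clique_number G.
Proof. by move=> Ac; rewrite /clique_number (bigmax_sup A). Qed.

End Distance.

(** * Directed edges and their endpoints *)

Section Arcs.
Variable G : sgraph.

Notation arc := (oriented_edge G * bool)%type.
Implicit Types (A B C : arc).

(* The flag tells whether the edge is traversed backwards. *)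
Definition src A : G := if A.2 then (val A.1).2 else (val A.1).1.
Definition rev_arc A : arc := (A.1, ~~ A.2).

Lemma rev_arcK : involutive rev_arc.
Proof. by case=> x b; rewrite /rev_arc /= negbK. Qed.

Lemma src_inj A B : A.1 = B.1 -> src A = src B -> A = B.
Proof.
case: A B => [x b] [y b'] /= <-; rewrite /src /=.
have xx : (val x).1 != (val x).2.
  by case/andP: (valP x) => /[swap] _; apply: contraTneq => ->; rewrite adj_irrefl.
by case: b; case: b' => // E; move: xx; rewrite E eqxx.
Qed.

Definition tgt A := src (rev_arc A).

Lemma adj_src_tgt A : adj (src A) (tgt A).
Proof.
by case: A => x []; rewrite /src /tgt /=; case/andP: (valP x) => // + _; rewrite adj_sym.
Qed.

(** Each edge is stored once, in increasing rank, so arcs with the same ends cannot come from pairs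
    stored in opposite orders. *)
Lemma src_tgt_inj A B : src A = src B -> tgt A = tgt B -> A = B.
Proof.
move=> sAB tAB; apply: src_inj => //; apply: val_inj.
case: A B sAB tAB => [[[x1 x2] xP] b] [[[y1 y2] yP] b']; rewrite /tgt /src /=.
case/andP: (xP) => _ /= x12; case/andP: (yP) => _ /= y12.
by case: b; case: b' => /= E1 E2; move: x12 y12; rewrite E1 E2 => //; lia.
Qed.

Lemma arc_of_adj u v : adj u v -> exists2 A, src A = u & tgt A = v.
Proof.
move=> uv; have uv' : u != v by apply: contraTneq uv => ->; rewrite adj_irrefl.
have : nat_of_ord (enum_rank u) != enum_rank v.
  by rewrite (inj_eq val_inj) (inj_eq enum_rank_inj).
rewrite neq_ltn => /orP[lt_uv|lt_vu].
  have xP : adj (u, v).1 (u, v).2 && (enum_rank (u, v).1 < enum_rank (u, v).2).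
    by rewrite uv lt_uv.
  by exists (Sub (u, v) xP, false).
have xP : adj (v, u).1 (v, u).2 && (enum_rank (v, u).1 < enum_rank (v, u).2).
  by rewrite adj_sym uv lt_vu.
by exists (Sub (v, u) xP, true).
Qed.

Lemma card_arcs_from u : #|[set A | src A == u]| = degree u.
Proof.
have tgt_inj : {in [set A | src A == u] &, injective tgt}.
  by move=> A B; rewrite !inE => /eqP sA /eqP sB; apply: src_tgt_inj; rewrite sB.
rewrite -(card_in_imset tgt_inj) /degree; apply: eq_card => v; rewrite inE.
apply/imsetP/idP => [[A]|/arc_of_adj[A sA tA]].
  by rewrite inE => /eqP <- ->; apply: adj_src_tgt.
by exists A => //; rewrite inE sA.
Qed.

End Arcs.

(** * Points of a subdivision and the shape of its short walks *)

Section Subdivision.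
Variables (G : sgraph) (n : nat).
Hypothesis n_gt0 : 0 < n.

Notation arc := (oriented_edge G * bool)%type.
Implicit Types (A B C : arc).

(* The point at distance [p <= n] from [src A] on the path replacing [A]. *)
Definition arc_point A p : subdivision G n :=
  sub_point n A.1 (if A.2 then n - p else p).

Lemma arc_point_rev A p : p <= n -> arc_point (rev_arc A) (n - p) = arc_point A p.
Proof. by move=> pn; rewrite /arc_point /=; case: A.2 => //=; rewrite subKn. Qed.

Lemma sub_point_inner (x : oriented_edge G) (i : 'I_n.-1) :
  sub_point n x i.+1 = inr (x, i).
Proof. by rewrite /sub_point /= valK. Qed.

Lemma sub_point_last (x : oriented_edge G) : sub_point n x n = inl (val x).2
    :> sub_vertex G n.
Proof.
by rewrite /sub_point; case: n n_gt0 => //= n' _; rewrite insubF // ltnn.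
Qed.

Lemma arc_point0 A : arc_point A 0 = inl (src A).
Proof. by rewrite /arc_point /src; case: A.2; rewrite ?subn0 ?sub_point_last. Qed.

Lemma arc_pointn A : arc_point A n = inl (src (rev_arc A)).
Proof. by rewrite -[in LHS](rev_arcK A) -[n in LHS]subn0 arc_point_rev // arc_point0. Qed.

Lemma arc_point_inner A p : 0 < p < n ->
  exists2 i : 'I_n.-1, arc_point A p = inr (A.1, i) & i.+1 = if A.2 then n - p else p.
Proof.
move=> pn; have lt_q : (if A.2 then n - p else p).-1 < n.-1 by case: A.2; lia.
exists (Ordinal lt_q); last by rewrite /=; case: A.2; lia.
rewrite -sub_point_inner /arc_point /=; congr sub_point; case: A.2; lia.
Qed.

Lemma arc_point_inl A p u : p <= n -> arc_point A p = inl u ->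
  p = 0 /\ src A = u \/ p = n /\ src (rev_arc A) = u.
Proof.
move=> pn; case: (posnP p) => [->|p0]; first by rewrite arc_point0 => -[->]; left.
have [->|pn'] := eqVneq p n; first by rewrite arc_pointn => -[->]; right.
by have [|i -> //] := @arc_point_inner A p; first lia.
Qed.

(** An interior point belongs to a single edge, so only the direction of traversal is ambiguous. *)
Lemma arc_point_inj A B p q : 0 < p < n -> q <= n -> arc_point A p = arc_point B q ->
  B = A /\ q = p \/ B = rev_arc A /\ q = n - p.
Proof.
move=> pn qn; have [i -> iE] := arc_point_inner A pn.
have [->|q0] := posnP q; first by rewrite arc_point0.
have [->|qn'] := eqVneq q n; first by rewrite arc_pointn.
have [|j -> jE [Ex ij]] := @arc_point_inner B q; first lia.
move: iE; rewrite ij jE; case: A B Ex {jE} => [x b] [y b'] /= <-.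
by case: b; case: b' => E; [left|right|right|left]; split=> //; lia.
Qed.

Lemma sub_adjP (a b : subdivision G n) :
  adj a b -> exists A k, [/\ k < n, a = arc_point A k & b = arc_point A k.+1].
Proof.
move=> /existsP[x /existsP[k /orP[]/andP[/eqP-> /eqP->]]].
  by exists (x, false), k; split.
exists (x, true), (n - k.+1); rewrite /arc_point /=; have := ltn_ord k.
by split; [|congr sub_point|congr sub_point]; lia.
Qed.

Lemma adj_arc_point A k : k < n -> adj (arc_point A k) (arc_point A k.+1).
Proof.
move=> kn; apply/existsP; exists A.1; apply/existsP; rewrite /arc_point.
case: A.2.
  have kn' : n - k.+1 < n by lia.
  exists (Ordinal kn') => /=; apply/orP; right.
  by rewrite (_ : n - k = (n - k.+1).+1) ?eqxx //; lia.
by exists (Ordinal kn); rewrite !eqxx.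
Qed.

Lemma within_arc_point A p : p <= n ->
  within p (inl (src A) : subdivision G n) (arc_point A p).
Proof.
rewrite -(arc_point0 A); elim: p => [|p IH] pn; first by exists [::].
rewrite -[X in within X]addn1; apply: within_trans (IH (ltnW pn)) _.
exists [:: arc_point A p.+1] => //; split=> //.
by rewrite [path _ _ _]andbT; apply: adj_arc_point.
Qed.

(** With [l < n] a walk cannot meet two distinct vertices of [G], so its ends lie on one arc or on
    two arcs leaving the same vertex. *)
Variant close l (a b : subdivision G n) : Prop :=
| CloseEdge A i j of i <= j <= n & j - i <= l &
    a = arc_point A i & b = arc_point A j
| CloseVertex A B i j of src A = src B & i + j <= l &
    a = arc_point A i & b = arc_point B j.

Lemma close_step l a b b' : l.+1 < n -> close l a b -> adj b b' -> close l.+1 a b'.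
Proof.
move=> ln + /sub_adjP[C [k [kn bE ->]]]; case.
- move=> A i j ijn ijl aE; rewrite bE {b bE} => /esym E.
  have [k0|k_gt0] := posnP k.
    rewrite k0 arc_point0 in E *; case: (arc_point_inl _ E); first lia.
      move=> [j0 sA]; apply: (@CloseEdge _ _ _ C 0 1); rewrite ?subn0 ?aE //.
      by rewrite (_ : i = 0) ?arc_point0 ?sA //; lia.
    move=> [jn sA]; apply: (@CloseVertex _ _ _ (rev_arc A) C (n - i) 1) => //; first lia.
    by rewrite aE arc_point_rev //; lia.
  case: (@arc_point_inj C A k j) => //; try lia.
    move=> [eA jk]; rewrite -{}eA; apply: (@CloseEdge _ _ _ A i k.+1) => //; lia.
  (* The step runs backwards along [A]: it shortens the stretch from [i] to [j], unless [i = j],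
     when the new point lies on the other side of [a]. *)
  move=> [eA jk]; have [ij|ij] := eqVneq i j.
    apply: (@CloseEdge _ _ _ C k k.+1) => //; try lia.
    by rewrite aE eA ij jk arc_point_rev //; lia.
  apply: (@CloseEdge _ _ _ A i j.-1) => //; try lia.
  by rewrite -(@arc_point_rev C k.+1 kn) -eA; congr (arc_point _ _); lia.
- move=> A B i j sAB ijl aE; rewrite bE {b bE} => /esym E.
  have [k0|k_gt0] := posnP k.
    rewrite k0 arc_point0 in E *; case: (arc_point_inl _ E) => [|[j0 sB]|]; try lia.
    by apply: (@CloseVertex _ _ _ A C i 1); rewrite ?sAB //; lia.
  case: (@arc_point_inj C B k j) => //; try lia.
    move=> [eB jk]; rewrite -{}eB in sAB *.
    by apply: (@CloseVertex _ _ _ A B i k.+1) => //; lia.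
  move=> [eB jk]; apply: (@CloseVertex _ _ _ A B i j.-1) => //; try lia.
  by rewrite -(@arc_point_rev C k.+1 kn) -eB; congr (arc_point _ _); lia.
Qed.

Lemma within_close l (a b : subdivision G n) :
  l < n -> a != b -> within l a b -> close l a b.
Proof.
move=> ln ab [p [ap pE] pl].
suff H : close (size p) a b.
  case: H => [A i j ij ijp ? ?|A B i j ? ijp ? ?].
    by apply: (@CloseEdge _ _ _ A i j); rewrite // (leq_trans ijp).
  by apply: (@CloseVertex _ _ _ A B i j); rewrite // (leq_trans ijp).
have {ln pl} pn : size p < n by apply: leq_ltn_trans pl ln.
(* The induction starts at length 1: an isolated vertex lies on no arc, so it is not [close] to
   itself. *)
have {ab pE} : 0 < size p /\ last a p = b.
  by split=> //; case: p pE {ap pn} => //= E; rewrite E eqxx in ab.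
elim/last_ind: p b ap pn => [|p b' IH] b /=; first by move=> _ _ [].
rewrite rcons_path last_rcons size_rcons => /andP[ap ab'] pn [_ <-].
have [p0|p_gt0] := posnP (size p); last first.
  by apply: close_step ab' => //; apply: IH => //; apply: ltnW.
move: ab'; rewrite (size0nil p0) /= => /sub_adjP[A [j [jn -> ->]]].
by apply: (@CloseEdge _ _ _ A j j.+1); rewrite // ?leqnSn // subSnn.
Qed.

End Subdivision.

(** * The clique around a vertex *)

Lemma clique_number_frac_power (G : sgraph) n k (v : G) :
    2 * k + 1 < n -> 0 < degree v ->
  degree v * k + 2 <= clique_number (frac_power G (2 * k + 1) n).
Proof.
move=> ln deg_gt0; have n_gt0 : 0 < n by lia.
pose from := [set A : oriented_edge G * bool | src A == v].
have cfrom : #|from| = degree v := card_arcs_from v.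
have /card_gt0P[A0 A0v] : 0 < #|from| by rewrite cfrom.
(* Index [i] stands for distance [i + 1] from [v]: the indices other than [ord_max] give the
   distances 1 to [k], and [(A0, ord_max)] is the extra point. *)
pose T : {set (oriented_edge G * bool) * 'I_k.+1} :=
  (A0, ord_max) |: setX from (~: [set ord_max]).
pose pt (q : (oriented_edge G * bool) * 'I_k.+1) : frac_power G (2 * k + 1) n :=
  arc_point n q.1 q.2.+1.
have inT q : q \in T -> src q.1 = v.
  by rewrite !inE => /orP[/eqP->|/andP[/eqP ->]] //=; move: A0v; rewrite inE => /eqP.
have pt_inj : {in T &, injective pt}.
  move=> [A i] [B j] /inT /= sA /inT /= sB E.
  have in_range (h : 'I_k.+1) : 0 < h.+1 < n by have := ltn_ord h; lia.
  have jn : j.+1 <= n by case/andP: (in_range j) => _ /ltnW.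
  case: (arc_point_inj n_gt0 (in_range i) jn E) => -[/= AB ij].
    by move: ij => [/val_inj ->]; rewrite AB.
  (* Reaching the same point from the other end would make an edge from [v] to itself. *)
  by have := adj_src_tgt A; rewrite /tgt -AB sA sB adj_irrefl.
have cT : #|T| = (degree v * k).+1.
  rewrite cardsU1 cardsX cfrom cardsC1 card_ord inE /= !inE eqxx andbF.
  by rewrite add1n.
have within_v q : q \in T -> within q.2.+1 (inl v : subdivision G n) (pt q).
  move=> qT; rewrite -(inT q qT); apply: within_arc_point => //.
  by have := ltn_ord q.2; lia.
have vN : (inl v : frac_power G (2 * k + 1) n) \notin pt @: T.
  apply/imsetP => -[q qT]; have [|i] := @arc_point_inner G n n_gt0 q.1 q.2.+1.
    by have := ltn_ord q.2; lia.
  by rewrite /pt => ->.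
have := @clique_number_ge (frac_power G (2 * k + 1) n) (inl v |: pt @: T).
rewrite cardsU1 vN card_in_imset // cT add1n addn2; apply.
have pow_sym : symmetric (@adj (frac_power G (2 * k + 1) n)) by apply: adj_sym.
have vT q : q \in T -> adj (inl v : frac_power G (2 * k + 1) n) (pt q).
  move=> qT; apply/power_adjP; split; last first.
    by apply: withinW (within_v _ qT); have := ltn_ord q.2; lia.
  by apply: contraNneq vN => ->; apply: imset_f.
apply/forallP => x; apply/implyP => xT; apply/forallP => y; apply/implyP => yT.
apply/implyP => xy.
case/setU1P: xT xy => [->|/imsetP[p pT ->]]; case/setU1P: yT => [->|/imsetP[q qT ->]].
- by rewrite eqxx.
- by move=> _; apply: vT.
- by move=> _; rewrite pow_sym vT.
move=> pq; apply/power_adjP; split=> //.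
(* The walk through [v] has length at most [k + (k + 1)], as only one chosen point is at distance
   [k + 1]. *)
apply: withinW (within_trans (within_sym (within_v _ pT)) (within_v _ qT)).
have pq' : p != q by apply: contraNneq pq => ->.
move: pT qT pq'; rewrite !inE; case: p {pq} => [A i]; case: q => [B j] /=.
rewrite !xpair_eqE /=.
have lt_k (h : 'I_k.+1) : h != ord_max -> h < k.
  by rewrite -(inj_eq val_inj) /=; have := ltn_ord h; lia.
move=> /orP[/andP[/eqP-> /eqP->]|/andP[_ /lt_k ik]];
  move=> /orP[/andP[/eqP-> /eqP->]|/andP[_ /lt_k jk]];
  rewrite ?eqxx //= => _; lia.
Qed.

(** The condition [g != d] sits inside the existential so that [xchoose] applies to any two
    colours. *)
Lemma two_other_colors D (g d : 'I_D) : 3 < D ->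
  exists ef : 'I_D * 'I_D, (g != d) ==> uniq [:: g; d; ef.1; ef.2].
Proof.
move=> D_gt3; have : 1 < #|~: [set g; d]|.
  by have := cardsC [set g; d]; rewrite card_ord cards2; case: (g != d); lia.
move=> /card_gt1P[e [f [eP fP ef]]]; exists (e, f); apply/implyP => gd.
move: eP fP; rewrite /= !inE !negb_or (eq_sym e g) (eq_sym e d) (eq_sym f g) (eq_sym f d).
by rewrite gd ef => /andP[-> ->] /andP[-> ->].
Qed.

(** * Colouring the subdivision *)

Notation spare i := (@Ordinal 4 i isT).

Section Pattern.
Variables (D k : nat).

Notation color := ('I_D * 'I_k + 'I_4)%type.
Implicit Types (g e : 'I_D) (a z : 'I_4).

(* With [t = p %% (2k + 2)] the successive values are
   [z, (g, 0), ..., (g, k - 1), a, (e, k - 1), ..., (e, 0)]. *)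
Definition periodic g e a z p : color :=
  let t := p %% (2 * k + 2) in
  if t == 0 then inr z
  else if insub t.-1 is Some l then inl (g, l)
  else if insub (2 * k + 1 - t) is Some l then inl (e, l)
  else inr a.

Variant periodic_spec g e a z t : color -> Prop :=
| PeriodicZero of t = 0 : periodic_spec g e a z t (inr z)
| PeriodicUp (l : 'I_k) of t = l.+1 : periodic_spec g e a z t (inl (g, l))
| PeriodicTop of t = k.+1 : periodic_spec g e a z t (inr a)
| PeriodicDown (l : 'I_k) of t + l = 2 * k + 1 : periodic_spec g e a z t (inl (e, l)).

Lemma periodicP g e a z p :
  periodic_spec g e a z (p %% (2 * k + 2)) (periodic g e a z p).
Proof.
rewrite /periodic; set t := _ %% _; have : t < 2 * k + 2 by rewrite ltn_mod; lia.
move: t => t lt_t; case: (posnP t) => [-> | t0]; first by constructor.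
case: insubP => [l _ lE | Nl]; first by constructor; rewrite lE; lia.
case: insubP => [l _ lE | Nl']; first by constructor; rewrite lE; lia.
constructor; lia.
Qed.

(** Positions at most [2k + 1] apart differ modulo the period, and the [2k + 2] values within a
    period are distinct. *)
Lemma periodic_neq g e a z p q :
  g != e -> a != z -> p < q <= p + (2 * k + 1) ->
  periodic g e a z p != periodic g e a z q.
Proof.
move=> ge az pq; have tt : p %% (2 * k + 2) <> q %% (2 * k + 2).
  move/eqP; rewrite eq_sym eqn_mod_dvd; last lia.
  by move/dvdn_leq; lia.
case: periodicP => [t|l t|t|l t]; case: periodicP => [t'|l' t'|t'|l' t'];
  apply/eqP => E; try discriminate E; try (case: E => *; subst);
  first [lia | by rewrite eqxx in ge | by rewrite eqxx in az].
Qed.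

(* The vertices of [G] get the colour [inr 0]. The two halves of an edge share
   no colour, except that [inr 0] occurs periodically on the first half but only
   at the end of the second half. *)
Definition edge_color n g d e f p : color :=
  if p <= n - p then periodic g e (spare 1) (spare 0) p
  else if p == n then inr (spare 0) else periodic d f (spare 2) (spare 3) (n - p).


Section EdgeColor.
Variables (n : nat) (g d e f : 'I_D).
Hypothesis ln : 2 * k + 1 < n.

Lemma edge_color_neq p q :
  uniq [:: g; d; e; f] -> p < q <= p + (2 * k + 1) -> q <= n ->
  edge_color n g d e f p != edge_color n g d e f q.
Proof.
rewrite /= !inE !negb_or => /and4P[/and3P[gd ge gf] /andP[de df] ef _] pq qn.
rewrite /edge_color; case: leqP => lep; case: leqP => leq.
- by apply: (@periodic_neq _ _ (spare 1) (spare 0)).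
- have [qE|qn'] := eqVneq q n.
    (* Here [p <= n - p <= 2k + 1], so the end colour could recur only at [p = 0], which is too far
       from [n]. *)
    case: periodicP => [|//|//|//]; rewrite modn_small; lia.
  by case: periodicP => [t|l t|t|l t]; case: periodicP => [t'|l' t'|t'|l' t'];
    apply/eqP => E; try discriminate E; case: E => *; subst;
    first [by rewrite eqxx in gd | by rewrite eqxx in gf | by rewrite eqxx in de
          | by rewrite eqxx in ef].
- lia.
- rewrite (_ : p == n = false); last by apply/eqP; lia.
  have [qE|qn'] := eqVneq q n; last first.
    by rewrite eq_sym; apply: (@periodic_neq _ _ (spare 2) (spare 3)) => //; lia.
  by case: periodicP => [|//|//|//]; rewrite modn_small; lia.
Qed.

Lemma edge_color_near p : p < k -> exists2 l : 'I_k, l = p :> nat &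
  edge_color n g d e f p.+1 = inl (g, l).
Proof.
move=> pk; rewrite /edge_color (_ : p < n - p.+1); last lia.
have pE : p.+1 %% (2 * k + 2) = p.+1 by rewrite modn_small //; lia.
case: periodicP => [|l||l]; rewrite pE => E; try lia; last by have := ltn_ord l; lia.
by exists l => //; lia.
Qed.

Lemma edge_color_near_rev p : p < k -> exists2 l : 'I_k, l = p :> nat &
  edge_color n g d e f (n - p.+1) = inl (d, l).
Proof.
move=> pk; rewrite /edge_color leqNgt (_ : n - (n - p.+1) < n - p.+1) /=; last lia.
rewrite (_ : n - p.+1 == n = false) ?subKn; try lia.
have pE : p.+1 %% (2 * k + 2) = p.+1 by rewrite modn_small //; lia.
case: periodicP => [|l||l]; rewrite pE => E; try lia; last by have := ltn_ord l; lia.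
by exists l => //; lia.
Qed.

(** On the first half [p] is in the descending run, so [l + p = 2k + 1]. On the second half either
    [l + p = n - 1], or [l = 2k + 1 - (n - p)] with [n - p < p]. *)
Lemma edge_color_far p g' (l : 'I_k) :
    k < p <= 2 * k -> edge_color n g d e f p = inl (g', l) ->
  2 * k + 1 <= l + p.
Proof.
rewrite /edge_color => pk; case: leqP => lep.
  case: periodicP => // l'; rewrite modn_small; try lia; move=> ? [_ <-];
    have := ltn_ord l'; lia.
rewrite (_ : p == n = false); last by apply/eqP; lia.
case: periodicP => // l'; rewrite modn_small; try lia; move=> ? [_ <-];
  have := ltn_ord l'; lia.
Qed.

Lemma edge_color_far_rev p g' (l : 'I_k) :
    k < p <= 2 * k -> edge_color n g d e f (n - p) = inl (g', l) ->
  2 * k + 1 <= l + p.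
Proof.
rewrite /edge_color => pk; rewrite subKn; last lia.
case: leqP => lep.
  case: periodicP => // l'; rewrite modn_small; try lia; move=> ? [_ <-];
    have := ltn_ord l'; lia.
rewrite (_ : n - p == n = false); last by apply/eqP; lia.
case: periodicP => // l'; rewrite modn_small; try lia; move=> ? [_ <-];
  have := ltn_ord l'; lia.
Qed.

Lemma edge_color0 : edge_color n g d e f 0 = inr (spare 0).
Proof. by rewrite /edge_color leq0n /periodic mod0n. Qed.

Lemma edge_colorn : edge_color n g d e f n = inr (spare 0).
Proof. by rewrite /edge_color subnn leqNgt (_ : 0 < n) ?eqxx //; lia. Qed.

End EdgeColor.

End Pattern.

(** * Assembling the edge patterns into a proper colouring *)

Section Coloring.
Variables (G : sgraph) (D k n : nat) (c : {ffun G * G -> 'I_D}).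
Hypothesis ln : 2 * k + 1 < n.
Hypothesis c_out : proper_out c.
Hypothesis c_free : forall u v : G, adj u v -> c (u, v) != c (v, u).
Variable ef : oriented_edge G -> 'I_D * 'I_D.
Hypothesis ef_uniq : forall x : oriented_edge G,
  uniq [:: c (val x); c ((val x).2, (val x).1); (ef x).1; (ef x).2].

Let n_gt0 : 0 < n. Proof. by lia. Qed.

Definition point_color (a : subdivision G n) : 'I_D * 'I_k + 'I_4 :=
  match a with
  | inl _ => inr (spare 0)
  | inr (x, i) =>
      edge_color k n (c (val x)) (c ((val x).2, (val x).1)) (ef x).1 (ef x).2 i.+1
  end.

Definition arc_color (A : oriented_edge G * bool) p : 'I_D * 'I_k + 'I_4 :=
  edge_color k n (c (val A.1)) (c ((val A.1).2, (val A.1).1)) (ef A.1).1 (ef A.1).2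
    (if A.2 then n - p else p).

(** A vertex may lie on several arcs; they agree on it because both ends of every edge pattern carry
    the spare colour 0. *)
Lemma point_color_arc A p : p <= n -> point_color (arc_point n A p) = arc_color A p.
Proof.
move=> pn; have [->|p_gt0] := posnP p.
  rewrite arc_point0 // /arc_color; case: A.2.
    by rewrite subn0 edge_colorn.
  by rewrite edge_color0.
have [->|pn'] := eqVneq p n.
  rewrite arc_pointn // /arc_color; case: A.2.
    by rewrite subnn edge_color0.
  by rewrite edge_colorn.
have [|i -> iE] := @arc_point_inner _ n n_gt0 A p; first lia.
by rewrite /= iE.
Qed.

Lemma arc_color_neq A p q : p < q <= p + (2 * k + 1) -> q <= n ->
  arc_color A p != arc_color A q.
Proof.
move=> pq qn; rewrite /arc_color; case: A.2; last exact: edge_color_neq.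
by rewrite eq_sym edge_color_neq //; lia.
Qed.

Lemma arc_color_near A p : p < k -> exists2 l : 'I_k, l = p :> nat &
  arc_color A p.+1 = inl (c (src A, tgt A), l).
Proof.
move=> pk; case: A => x [] /=; rewrite /arc_color /src /tgt /src /=.
  exact: (edge_color_near_rev _ _ _ _ ln pk).
by rewrite -surjective_pairing; exact: (edge_color_near _ _ _ _ ln pk).
Qed.

Lemma arc_color_far A p g' (l : 'I_k) :
  k < p <= 2 * k -> arc_color A p = inl (g', l) -> 2 * k + 1 <= l + p.
Proof.
rewrite /arc_color; case: A.2; first exact: edge_color_far_rev.
exact: edge_color_far.
Qed.

(** Take [j <= i], so [j <= k] and [j] has level [j - 1]. If [i <= k], the half-edge colours at the
    common source differ; if [i > k], equal levels would force [2k + 1 <= (j - 1) + i]. *)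
Lemma arc_color_vertex A B i j :
    src A = src B -> A != B -> 0 < i -> 0 < j -> i + j <= 2 * k + 1 ->
  arc_color A i != arc_color B j.
Proof.
move=> + + + + ij; wlog ji : A B i j ij / j <= i.
  move=> W; case: (leqP j i) => [ji|/ltnW ij']; first exact: W.
  by move=> *; rewrite eq_sym W // 1?addnC // eq_sym.
case: i j ij ji => [|i] [|j] // ij ji sAB AB _ _.
have [|l lj ->] := @arc_color_near B j; first lia.
have [ik|ki] := ltnP i k.
  have [l' _ ->] := arc_color_near A ik; apply/eqP => -[/= cAB _].
  case/eqP: AB; apply: src_tgt_inj => //; move: cAB; rewrite -sAB.
  by apply: (proper_outP _ c_out); rewrite ?adj_src_tgt // sAB adj_src_tgt.
by apply/eqP => /arc_color_far; lia.
Qed.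

Lemma point_color_close a b : close (2 * k + 1) a b -> a != b ->
  point_color a != point_color b.
Proof.
have same A p q : p < q -> q <= n -> q <= p + (2 * k + 1) ->
    point_color (arc_point n A p) != point_color (arc_point n A q).
  by move=> pq qn qp; rewrite !point_color_arc ?arc_color_neq //; lia.
case=> [A i j ijn ijk -> -> | A B i j sAB ij -> ->] ab.
  have [E|ij] := eqVneq i j; first by rewrite E eqxx in ab.
  by apply: same; lia.
have [AB|AB] := eqVneq A B.
  rewrite -{}AB in ab *; case: (ltngtP i j) => [lt|gt|E]; last by rewrite E eqxx in ab.
    by apply: same; lia.
  by rewrite eq_sym; apply: same; lia.
have [i0|i_gt0] := posnP i; have [j0|j_gt0] := posnP j.
- by rewrite i0 j0 !arc_point0 // sAB eqxx in ab.
(* The common vertex is also the point at distance 0 on the other arc, so a single arc contains both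
   points. *)
- by rewrite i0 arc_point0 // sAB -(arc_point0 n_gt0); apply: same; lia.
- by rewrite j0 eq_sym arc_point0 // -sAB -(arc_point0 n_gt0); apply: same; lia.
by rewrite !point_color_arc ?arc_color_vertex //; lia.
Qed.

End Coloring.

Theorem theorem5p4 (m n : nat) (G : sgraph)
    (m_gt0 : 0 < m) (n_gt0 : 0 < n) (lt_mn : m < n) (odd_m : odd m)
    (G_conn : connected G) (G_ncomplete : ~~ complete G)
    (G_deg : 4 <= max_degree G) :
  chromatic_number (frac_power G m n) <= clique_number (frac_power G m n) + 2.
Proof.
have {m_gt0 odd_m} [k mE] : exists k, m = 2 * k + 1 by exists m./2; lia.
rewrite {m}mE in lt_mn *; set D := max_degree G in G_deg.
have G_gt0 : 0 < #|G|.
  rewrite lt0n; apply: contraL G_deg => /eqP G0; rewrite /D /max_degree.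
  by rewrite big_pred0 // => x; have := fintype0 x G0.
have [v vD] : {v : G | D = degree v} by apply: eq_bigmax.
have degD (u : G) : degree u <= D by apply: leq_bigmax.
have [c c_out c_free] := clash_free_exists G_conn (ltnW G_deg) degD.
have [ef ef_uniq] : exists ef : oriented_edge G -> 'I_D * 'I_D, forall x,
    uniq [:: c (val x); c ((val x).2, (val x).1); (ef x).1; (ef x).2].
  exists (fun x => xchoose (two_other_colors (c (val x)) (c ((val x).2, (val x).1)) G_deg)).
  move=> x; apply: (implyP (xchooseP (two_other_colors _ _ G_deg))).
  by case/andP: (valP x) => /c_free; rewrite -surjective_pairing.
have Dk : D * k + 2 <= clique_number (frac_power G (2 * k + 1) n).
  by rewrite vD clique_number_frac_power // -vD; lia.
apply: (@leq_trans (D * k + 2 + 2)); last by rewrite leq_add2r.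
apply: chromatic_number_le.
have -> : D * k + 2 + 2 = #|{: 'I_D * 'I_k + 'I_4}|.
  by rewrite card_sum card_prod !card_ord -addnA.
apply: (@colorable_finType (frac_power G (2 * k + 1) n) _ (@point_color G D k n c ef)) => a b.
case/power_adjP => ab /within_close-/(_ n_gt0 lt_mn ab) cab.
exact: point_color_close cab ab.
Qed.
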